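(* Let $q$ be a monic real-rooted polynomial of degree $d$ with $q\neq x^d$. Then its polar derivative $\dot\partial_x q=dq-xq'$, of degree $d-1$ or $d-2$, is always real-rooted and its roots interlace the roots of $q'$. Furthermore, $W[\dot\partial_x q,q']\ge 0$ (that is, the interlacing is positive between the polar derivative and the derivative), and when the roots of $q$ are simple, $W[\dot\partial_x q,q']>0$.
   Context: For a polynomial $q$ of degree $d$, the polar derivative is the polynomial $\dot\partial_x q:=dq-xq'$, which has degree at most $d-1$. The Wronskian of two polynomials is $W[f,g]:=f'g-g'f$ (note the sign convention); the inequalities on $W$ are meant at every real $x$. A polynomial is real-rooted if all its roots are real. Two real-rooted polynomials interlace when their roots, listed with multiplicity in decreasing order, alternate: for equal degree $n$ with roots $\lambda_i$ and $\mu_i$, $\lambda_1\ge\mu_1\ge\lambda_2\ge\mu_2\ge\dots\ge\lambda_n\ge\mu_n$ or the same with the roles exchanged; when the degrees are $n$ and $n-1$, $\lambda_1\ge\mu_1\ge\lambda_2\ge\dots\ge\mu_{n-1}\ge\lambda_n$.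
   Formalization: The strict inequality for simple roots is stated only for degree d at least 2, because for d = 1, q = x - a with a nonzero, the polar derivative is -a and q' = 1, so the Wronskian is identically 0. *)

(* Defs.v *)
From HB Require Import structures.
From mathcomp Require Import all_boot all_order all_algebra.
From mathcomp Require Import complex.

Set Implicit Arguments.
Unset Strict Implicit.
Unset Printing Implicit Defensive.

Import Order.TTheory GRing.Theory Num.Theory.
Local Open Scope ring_scope.

Section Interlacing.
Variable R : rcfType.
Implicit Types (p q f g : {poly R}) (s t : seq R).

(* Roots are taken in the algebraic closure R[i] of R. The zero polynomial is
   not real-rooted in this sense, since every z : R[i] is a root of it. *)
Definition real_rooted p : Prop :=
  forall z : R[i], root (map_poly (real_complex R) p) z -> z \is Num.real.

(* (size q).-1 is the degree of q (nonzero). *)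
Definition polar_deriv q : {poly R} :=
  (size q).-1%:R *: q - 'X * q^`().

(* The sign convention is opposite to the more usual f g' - f' g. *)
Definition wronskian f g : {poly R} := f^`() * g - g^`() * f.

Definition simple_roots p : Prop := forall x, root p x -> mup x p = 1%N.

Definition roots_decreasing p s : Prop :=
  sorted >=%R s /\ forall x, count_mem x s = mup x p.

(* s`_0 >= t`_0 >= s`_1 >= t`_1 >= ..., stopping when the entries run out. *)
Definition alternate s t : Prop :=
  forall i : nat,
    ((i < size s)%N -> (i < size t)%N -> t`_i <= s`_i) /\
    ((i < size t)%N -> (i.+1 < size s)%N -> s`_i.+1 <= t`_i).

Definition interlacing_seqs s t : Prop :=
  [\/ size s = size t /\ (alternate s t \/ alternate t s),
      size s = (size t).+1 /\ alternate s t
    | size t = (size s).+1 /\ alternate t s].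

Definition interlace p q : Prop :=
  [/\ real_rooted p, real_rooted q &
      exists s t, [/\ roots_decreasing p s, roots_decreasing q t
                    & interlacing_seqs s t]].

End Interlacing.

(* Main.v *)
Require Import Defs.
From mathcomp Require Import all_boot all_order all_algebra.
From mathcomp Require Import complex polyrcf polyorder.
From mathcomp Require Import ring lra zify.
Import Order.TTheory GRing.Theory Num.Theory.
Local Open Scope ring_scope.

(** Let u be the list of the distinct roots of q, with multiplicities w a, let
    D be the product of the X - a for a in u, N = D * (sum of w a / (X - a)), and
    G the product of the (X - a)^(w a - 1). Then q = G D, and
      q' = G N,   dq - X q' = G H   with H = d D - X N.
    The common factor G contributes the same roots to both sides, so that
    everything reduces to the pair H, N (excess_prod, pole_sum and
    polar_pole_sum stand for G, N and H).

    Sign of the Wronskian. A computation gives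
      W[H, N] = d (D' N - D N') - N^2,
    and, off the roots of D, its quotient by D^2 is
      (sum of w a) (sum of w a y a^2) - (sum of w a y a)^2,  y a = 1 / (x - a),
    the gap in the Cauchy-Schwarz inequality. The y a are distinct, so the gap
    is positive unless q has a single root, when it is 0. Adding one root at a
    time (pole_wronskian_cons, pole_wronskian_gt0) shows that positivity holds
    at the roots of D too. Since W[G H, G N] = G^2 W[H, N], both statements on
    the Wronskian follow; for simple roots, G = 1.

    Real-rootedness. A sum of terms w / (z - a) with w >= 0, not all zero, has
    nonzero imaginary part at every nonreal z (pole_sum_conj_gap). This applies
    to N, and to - X H / D, which is a real constant plus the sum of the
    w a * a^2 / (X - a); the hypothesis that q is not a power of X says that
    these weights are not all zero.

    Interlacing. Where W[H, N] > 0, H' N > 0 at the roots of H, and - H N' > 0 at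
    those of N. Hence the roots are simple and disjoint, and N changes sign
    between two roots of H, and conversely (wronskian_gt0_separates). Two finite
    sets that separate each other in this way have counting functions with
    difference in {0, 1}, or in {0, -1}, everywhere
    (separates_count_alternate). Adding the roots of G to both lists leaves the
    difference unchanged, and such a bound forces the sorted lists to alternate
    (count_alternate_sound). *)

Section PolarDerivative.
Set Implicit Arguments.
Unset Strict Implicit.
Variable R : rcfType.
Implicit Types (p q f g k : {poly R}) (s t u : seq R) (x y z a b c : R).
Implicit Types (w : R -> R) (e : R -> nat).

(** * Alternation by counting *)

Lemma gtr_trans : transitive (>%R : rel R).
Proof. by move=> y x z yx zy; apply: lt_trans yx. Qed.

Lemma ger_trans : transitive (>=%R : rel R).
Proof. by move=> y x z yx zy; apply: le_trans yx. Qed.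

Definition count_gt x s := count (fun y => x < y) s.

(** Alternation in terms of counting functions. Unlike the entrywise condition
    it is visibly stable under permutation and under adding common entries,
    which is how multiple roots of q are dealt with. The clause on sizes is the
    count above a point lying below all entries. *)
Definition count_alternate s t : Prop :=
  (size t <= size s <= (size t).+1)%N /\
  forall x, (count_gt x t <= count_gt x s <= (count_gt x t).+1)%N.

(** Converts counts into entries: the i-th entry of a decreasing list is above x
    exactly when more than i entries are. *)
Lemma count_gt_sorted s x i : sorted >=%R s -> (i < size s)%N ->
  (i < count_gt x s)%N = (x < s`_i).
Proof.
rewrite /count_gt; elim: s i => [//|a s IH] i /= sas szi.
have ss : sorted >=%R s := path_sorted sas.
have le_a : {in s, forall y, y <= a} := allP (order_path_min ger_trans sas).
have count0 : a <= x -> count (> x) s = 0%N.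
  move=> le_ax; apply/eqP; rewrite -leqn0 leqNgt -has_count; apply/hasPn=> y ys.
  by rewrite -leNgt (le_trans _ le_ax) // le_a.
have [le_ax|lt_xa] := leP a x.
  rewrite count0 //=; case: i szi => [|i] szi /=; first by rewrite ltNge le_ax.
  by apply/esym/negbTE; rewrite -leNgt (le_trans _ le_ax) // le_a // mem_nth.
by case: i szi => [|i] szi //=; rewrite add1n ltnS IH.
Qed.

(** If two entries were in the wrong order, the smaller of the two would be a
    point above which the counts differ in a forbidden way. *)
Lemma count_alternate_sound s t : sorted >=%R s -> sorted >=%R t ->
  count_alternate s t -> alternate s t.
Proof.
move=> ss st [_ cnt] i; split=> [lti_s lti_t|lti_t lti_s].
  rewrite leNgt; apply/negP => lt_st.
  have := cnt s`_i.
  have := count_gt_sorted s`_i st lti_t; rewrite lt_st.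
  have := count_gt_sorted s`_i ss lti_s; rewrite ltxx; lia.
rewrite leNgt; apply/negP => lt_ts.
have := cnt t`_i.
have := count_gt_sorted t`_i st lti_t; rewrite ltxx.
have := count_gt_sorted t`_i ss lti_s; rewrite lt_ts; lia.
Qed.

Lemma count_alternate_interlacing s t : sorted >=%R s -> sorted >=%R t ->
  count_alternate s t \/ count_alternate t s -> interlacing_seqs s t.
Proof.
move=> ss st [] c; have a := count_alternate_sound _ _ c; move: c => [sz _].
  have [e|ne] := eqVneq (size s) (size t).
    by apply: Or31; split=> //; left; apply: a.
  by apply: Or32; split; [lia | apply: a].
have [e|ne] := eqVneq (size s) (size t).
  by apply: Or31; split=> //; right; apply: a.
by apply: Or33; split; [lia | apply: a].
Qed.

Lemma count_alternate_perm s s' t t' : perm_eq s s' -> perm_eq t t' ->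
  count_alternate s t -> count_alternate s' t'.
Proof.
move=> ps pt [sz c]; split; first by rewrite -(perm_size ps) -(perm_size pt).
by move=> x; rewrite /count_gt -(permP ps) -(permP pt); apply: c.
Qed.

Lemma count_alternate_cat u s t :
  count_alternate s t -> count_alternate (u ++ s) (u ++ t).
Proof.
move=> [sz c]; split; first by rewrite !size_cat; lia.
by move=> x; have := c x; rewrite /count_gt !count_cat; lia.
Qed.

Definition separates t s : Prop := {in s &, forall x y, x < y ->
  exists2 z, z \in t & x < z < y}.

(** Induction on the total size: with a the largest entry of s, the hypotheses
    pass to t and s deprived of a, with the roles exchanged, because t has an
    entry between a and any other entry of s. Putting a back adds one to the
    count of s below a, and from a on all counts vanish. *)
Lemma separates_count_alternate_above s t :
  sorted >%R s -> sorted >%R t -> separates t s -> separates s t ->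
  (forall y, y \in t -> has (> y) s) -> count_alternate s t.
Proof.
have [n] := ubnP (size s + size t).
elim: n s t => // n IH [|a s] t szn.
  case: t szn => [|b t] _ _ _ _ _ ht; first by split.
  by have := ht b (mem_head _ _).
move=> sas st sep_ts sep_st ht.
have /allP lt_sa := order_path_min gtr_trans sas.
have lt_ta : {in t, forall y, y < a}.
  move=> y /ht /hasP[z]; rewrite inE => /predU1P[-> //|zs /lt_trans]; apply.
  exact: lt_sa.
have ss : sorted >%R s := path_sorted sas.
have [sz c] : count_alternate t s.
  apply: IH => //.
  - by move: szn => /=; lia.
  - move=> x y xt yt xy; have [z] := sep_st _ _ xt yt xy.
    rewrite inE => /predU1P[-> /andP[_ ya]|zs xzy]; last by exists z.
    by move: (lt_trans ya (lt_ta _ yt)); rewrite ltxx.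
  - by move=> x y xs ys xy; apply: sep_ts; rewrite ?inE ?xs ?ys ?orbT.
  - move=> y ys; apply/hasP.
    have [|||z zt /andP[yz _]] := sep_ts y a; last by exists z.
    + by rewrite inE ys orbT.
    + exact: mem_head.
    + exact: lt_sa.
split; first by move=> /=; lia.
move=> x; have := c x; rewrite /count_gt /=.
have [lt_xa|le_ax] := ltP x a; first by lia.
have c0 v : {in v, forall y, y < a} -> count (> x) v = 0%N.
  move=> lt_va; apply/eqP; rewrite -leqn0 leqNgt -has_count; apply/hasPn=> y yv.
  by rewrite -leNgt (le_trans (ltW (lt_va _ yv)) le_ax).
by rewrite (c0 s) // (c0 t).
Qed.

Lemma separates_count_alternate s t :
  sorted >%R s -> sorted >%R t -> separates t s -> separates s t ->
  {in s, forall x, x \notin t} ->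
  count_alternate s t \/ count_alternate t s.
Proof.
move=> ss st sts sst dis.
case: s => [|a s] in ss sts sst dis *.
  by right; apply: separates_count_alternate_above.
case: t => [|b t] in st sts sst dis *.
  by left; apply: separates_count_alternate_above.
have /allP lt_sa := order_path_min gtr_trans ss.
have /allP lt_tb := order_path_min gtr_trans st.
have [lt_ab|lt_ba|eq_ab] := ltgtP a b.
- right; apply: separates_count_alternate_above => // y.
  rewrite inE /= => /predU1P[->|/lt_sa lt]; first by rewrite lt_ab.
  by rewrite (lt_trans lt lt_ab).
- left; apply: separates_count_alternate_above => // y.
  rewrite inE /= => /predU1P[->|/lt_tb lt]; first by rewrite lt_ba.
  by rewrite (lt_trans lt lt_ba).
by have := dis a (mem_head _ _); rewrite eq_ab mem_head.
Qed.

(** * Root separation from a positive Wronskian *)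

Lemma size_mul_XsubC f a : f != 0 -> size (f * ('X - a%:P)) = (size f).+1.
Proof.
by move=> f0; rewrite size_mul ?polyXsubC_eq0 // size_XsubC addn2.
Qed.

(** A positive polynomial that reaches 0 does so, for the first time, while not
    increasing. The induction on the degree replaces the search for the first
    root: write k = (X - y) k2. If k2 is positive at y then it vanishes before
    y, and a root z of k2 with k2'(z) >= 0 satisfies k'(z) = (z - y) k2'(z). *)
Lemma root_derive_le0 k x y : x < y -> 0 < k.[x] -> root k y ->
  exists z, [/\ x < z, z <= y, root k z & k^`().[z] <= 0].
Proof.
have [n] := ubnP (size k); elim: n k x y => // n IH k x y szk lt_xy kx ky.
have [k2 Dk] := factor_theorem _ _ ky.
have k2z : k2 != 0 by apply: contraTneq kx => e; rewrite Dk e mul0r horner0 ltxx.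
have szk2 : (size k2 < n)%N.
  by move: szk; rewrite Dk size_mul_XsubC.
have dk z : k^`().[z] = k2.[z] + (z - y) * k2^`().[z].
  rewrite Dk !derivE !hornerE; ring.
have k2x : k2.[x] < 0 by move: kx; rewrite Dk !hornerE; nra.
have [k2y|k2y] := leP k2.[y] 0.
  by exists y; split=> //; rewrite dk subrr mul0r addr0.
have [|z0 /[!in_itv]/= /andP[xz0 z0y] k2z0] := @poly_ivtoo _ k2 x y (ltW lt_xy).
  nra.
have [||||z [xz zz0]] := IH (- k2) x z0.
- by rewrite size_polyN.
- by [].
- by rewrite hornerN oppr_gt0.
- by rewrite rootN.
rewrite rootN derivN hornerN => kz dkz; exists z; split=> //.
- by rewrite (le_trans zz0) // ltW.
- by rewrite Dk rootM kz.
rewrite dk (eqP kz); have : z < y by apply: le_lt_trans z0y.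
nra.
Qed.

(** At a root of f the Wronskian is f' g. With g(x) > 0, f leaves x upwards, so
    it has a root z up to y where f'(z) <= 0; then g(z) < 0, and g changes sign
    between x and z. *)
Lemma wronskian_gt0_separates f g :
  (forall x, root f x -> 0 < (wronskian f g).[x]) ->
  forall x y, root f x -> root f y -> x < y ->
  exists2 z, root g z & x < z < y.
Proof.
move=> W x y fx fy lt_xy.
wlog gx : f g W fx fy / 0 < g.[x].
  move=> H; have [gx|gx|g0] := ltgtP 0 g.[x].
  - exact: (H f g).
  - have [||||z gz xzy] := H (- f) (- g); rewrite ?rootN //.
    + move=> z; rewrite rootN => /W; rewrite /wronskian !derivE !hornerE; lra.
    + by rewrite hornerN oppr_gt0.
    + by exists z; rewrite // -rootN.
  - by have := W x fx; rewrite /wronskian !hornerE (eqP fx) -g0 !mulr0 subrr ltxx.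
have [k Df] := factor_theorem _ _ fx.
have dfE z : f^`().[z] = k.[z] + (z - x) * k^`().[z].
  rewrite Df !derivE !hornerE; ring.
have WE z : root f z -> (wronskian f g).[z] = f^`().[z] * g.[z].
  by move=> /eqP fz; rewrite /wronskian !hornerE fz mulr0 oppr0 addr0.
have kx : 0 < k.[x].
  by have := W x fx; rewrite WE // dfE subrr mul0r addr0 pmulr_lgt0.
have ky : root k y.
  by move: fy; rewrite Df rootM root_XsubC (gt_eqF lt_xy) orbF.
have [z [xz zy kz dkz]] := root_derive_le0 lt_xy kx ky.
have fz : root f z by rewrite Df rootM kz.
have gz : g.[z] < 0.
  have := W z fz; rewrite WE // dfE (eqP kz) add0r => H.
  have : (z - x) * k^`().[z] <= 0 by nra.
  nra.
have [|v /[!in_itv]/= /andP[xv vz] gv] := @poly_ivtoo _ g x z (ltW xz); first nra.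
by exists v; rewrite ?xv ?(lt_le_trans vz).
Qed.

(** * Real-rooted polynomials and their root lists *)

Lemma real_rooted_neq0 f : real_rooted f -> f != 0.
Proof.
move=> rf; apply/eqP=> f0; have := rf (Complex 0 1).
by rewrite f0 rmorph0 root0 complex_real oner_eq0 => /(_ isT).
Qed.

Lemma real_rootedM f g : real_rooted f -> real_rooted g -> real_rooted (f * g).
Proof. by move=> rf rg z; rewrite rmorphM rootM => /orP[/rf|/rg]. Qed.

Lemma real_rooted_mull f g : real_rooted (f * g) -> real_rooted f.
Proof. by move=> rfg z fz; apply: rfg; rewrite rmorphM rootM fz. Qed.

Lemma real_rooted_split f : real_rooted f ->
  exists2 s, sorted >=%R s & f = lead_coef f *: \prod_(a <- s) ('X - a%:P).
Proof.
move=> rf; suff [s Df] : exists s, f = lead_coef f *: \prod_(a <- s) ('X - a%:P).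
  exists (sort >=%R s); first by apply: sort_sorted => x y; exact: le_total.
  rewrite {1}Df; congr (_ *: _); apply: perm_big; by rewrite perm_sym perm_sort.
have [n] := ubnP (size f); elim: n f rf => // n IH f rf szf.
have f0 := real_rooted_neq0 rf.
have [/size1_polyC Df|sz2] := leqP (size f) 1.
  by exists [::]; rewrite big_nil alg_polyC Df lead_coefC.
have [z fz] : exists z : R[i], root (map_poly (real_complex R) f) z.
  by apply/closed_rootP; rewrite size_map_poly neq_ltn sz2 orbT.
have /complex_realP[x Dz] := rf z fz.
have /factor_theorem[g Df] : root f x.
  by move: fz; rewrite Dz fmorph_root.
have rg : real_rooted g by apply: (@real_rooted_mull _ ('X - x%:P)); rewrite -Df.
have [|s Dg] := IH g rg.
  by move: szf; rewrite Df size_mul_XsubC // real_rooted_neq0.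
exists (x :: s); rewrite big_cons Df lead_coefM lead_coefXsubC mulr1 {1}Dg.
by rewrite mulrC scalerAr.
Qed.

Lemma mup_prod_XsubC s x : mup x (\prod_(a <- s) ('X - a%:P)) = count_mem x s.
Proof.
elim: s => [|a s IH]; first by rewrite big_nil mupNroot // root1.
have s0 : \prod_(a <- s) ('X - a%:P) != 0 :> {poly R}.
  by rewrite monic_neq0 // monic_prod_XsubC.
rewrite big_cons mupM ?polyXsubC_eq0 // IH /=; congr (_ + _)%N.
by have := mup_XsubCX 1 x a; rewrite expr1 => ->; case: eqP.
Qed.

Lemma mupZ c f x : c != 0 -> mup x (c *: f) = mup x f.
Proof. by move=> c0; rewrite -mul_polyC mupMr // rootC. Qed.

Lemma roots_decreasing_prod c s : c != 0 -> sorted >=%R s ->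
  roots_decreasing (c *: \prod_(a <- s) ('X - a%:P)) s.
Proof. by move=> c0 ss; split=> // x; rewrite mupZ // mup_prod_XsubC. Qed.

Lemma simple_roots_sorted_gt c f s : c != 0 -> sorted >=%R s ->
  f = c *: \prod_(a <- s) ('X - a%:P) ->
  (forall x, root f x -> ~~ root f^`() x) -> sorted >%R s.
Proof.
move=> c0 ss Df simf; have f0 : f != 0.
  by rewrite Df scaler_eq0 negb_or c0 monic_neq0 ?monic_prod_XsubC.
rewrite -[sorted _ _]rev_sorted lt_sorted_uniq_le rev_uniq rev_sorted ss andbT.
apply: count_mem_uniq => x.
have [xs|/count_memPn //] := boolP (x \in s).
apply/eqP; rewrite eqn_leq -has_count has_pred1 xs andbT leqNgt.
apply/negP; rewrite -mup_prod_XsubC -(mupZ _ _ c0) -Df mup_geq //.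
move=> /dvdpP[g Dg].
have fx : root f x by rewrite Dg rootM root_exp_XsubC eqxx orbT.
have /negP[] := simf _ fx; rewrite rootE Dg expr2 !derivM.
have lx : ('X - x%:P).[x] = 0 by rewrite hornerXsubC subrr.
by rewrite !(hornerD (_ * _), hornerM) lx !(mul0r, mulr0, addr0).
Qed.

(** A positive Wronskian makes the roots of f and g simple and disjoint, and it
    makes each root set separate the other, since W[g,-f] = W[f,g]. The roots of
    the common factor k then add equally to both counting functions. *)
Lemma interlace_of_wronskian k f g :
  real_rooted k -> real_rooted f -> real_rooted g ->
  (forall x, root f x || root g x -> 0 < (wronskian f g).[x]) ->
  interlace (k * f) (k * g).
Proof.
move=> rk rf rg W; split; [exact: real_rootedM..|].
have [u _ Dk] := real_rooted_split rk.
have [s ss Df] := real_rooted_split rf.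
have [t st Dg] := real_rooted_split rg.
have lk : lead_coef k != 0 by rewrite lead_coef_eq0 real_rooted_neq0.
have lf : lead_coef f != 0 by rewrite lead_coef_eq0 real_rooted_neq0.
have lg : lead_coef g != 0 by rewrite lead_coef_eq0 real_rooted_neq0.
have rootf x : root f x = (x \in s) by rewrite Df rootZ // root_prod_XsubC.
have rootg x : root g x = (x \in t) by rewrite Dg rootZ // root_prod_XsubC.
have Wf x : root f x -> 0 < (wronskian f g).[x] by move=> fx; rewrite W ?fx.
have Wg x : root g x -> 0 < (wronskian g (- f)).[x].
  move=> gx; have := W x; rewrite gx orbT => /(_ isT).
  by rewrite /wronskian !derivE !hornerE; lra.
have gt_s : sorted >%R s.
  apply: (simple_roots_sorted_gt lf ss Df) => x fx; apply/negP => /eqP dfx.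
  by have := Wf x fx; rewrite /wronskian !hornerE dfx (eqP fx); lra.
have gt_t : sorted >%R t.
  apply: (simple_roots_sorted_gt lg st Dg) => x gx; apply/negP => /eqP dgx.
  by have := Wg x gx; rewrite /wronskian !hornerE dgx (eqP gx); lra.
have alt : count_alternate s t \/ count_alternate t s.
  apply: separates_count_alternate => //.
  - move=> x y; rewrite -!rootf => fx fy xy.
    by have [z] := wronskian_gt0_separates Wf fx fy xy; rewrite rootg; exists z.
  - move=> x y; rewrite -!rootg => gx gy xy.
    have [z] := wronskian_gt0_separates Wg gx gy xy.
    by rewrite rootN rootf; exists z.
  - move=> x; rewrite -rootf -rootg => fx; apply/negP => gx.
    by have := Wf x fx; rewrite /wronskian !hornerE (eqP fx) (eqP gx); lra.
have sortP v : perm_eq (u ++ v) (sort >=%R (u ++ v)) by rewrite perm_sym perm_sort.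
have sortS v : sorted >=%R (sort >=%R (u ++ v) : seq R).
  by apply: sort_sorted => x y; exact: le_total.
exists (sort >=%R (u ++ s)), (sort >=%R (u ++ t)).
have prodE c c' v :
    (c *: \prod_(a <- u) ('X - a%:P)) * (c' *: \prod_(a <- v) ('X - a%:P)) =
    (c * c') *: \prod_(a <- sort >=%R (u ++ v)) ('X - a%:P) :> {poly R}.
  by rewrite -(perm_big _ (sortP v)) big_cat /= -scalerAl -scalerAr scalerA.
split.
- by rewrite {1}Dk {1}Df prodE; apply: roots_decreasing_prod; rewrite ?mulf_neq0.
- by rewrite {1}Dk {1}Dg prodE; apply: roots_decreasing_prod; rewrite ?mulf_neq0.
apply: count_alternate_interlacing => //.
by case: alt => a; [left|right];
  apply: count_alternate_perm (sortP _) (sortP _) _; apply: count_alternate_cat.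
Qed.

(** * Rational functions with simple poles *)

Definition pole_prod u : {poly R} := \prod_(a <- u) ('X - a%:P).

(** The numerator, over pole_prod u, of the sum of the w a / (X - a). *)
Fixpoint pole_sum w u : {poly R} :=
  if u is a :: u' then ('X - a%:P) * pole_sum w u' + w a *: pole_prod u' else 0.

(** The polar derivative of pole_prod u when all weights are 1; in general, the
    numerator of the sum of the - w a * a / (X - a). *)
Definition polar_pole_sum w u : {poly R} :=
  (\sum_(a <- u) w a) *: pole_prod u - 'X * pole_sum w u.

Lemma pole_prod_cons a u : pole_prod (a :: u) = ('X - a%:P) * pole_prod u.
Proof. by rewrite /pole_prod big_cons. Qed.

Lemma pole_prod1 a : pole_prod [:: a] = 'X - a%:P.
Proof. exact: big_seq1. Qed.

Lemma pole_sum1 w a : pole_sum w [:: a] = (w a)%:P.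
Proof. by rewrite /= /pole_prod big_nil mulr0 add0r alg_polyC. Qed.

(** The weights - w a * a of the polar sum have no fixed sign; multiplying by - X
    turns them into w a * a ^+ 2, up to a constant. Termwise this is X a / (X - a) = a + a^2 / (X - a). *)
Lemma mulX_polar_pole_sum w u :
  - ('X * polar_pole_sum w u) =
  (\sum_(a <- u) w a * a) *: pole_prod u + pole_sum (fun a => w a * a ^+ 2) u.
Proof.
elim: u => [|a u]; first by rewrite /polar_pole_sum !big_nil /= !scale0r; ring.
rewrite /polar_pole_sum !big_cons pole_prod_cons /= -!mul_polyC.
rewrite !(polyCD, polyCM, polyC_exp) => IH.
rewrite -[pole_sum _ u in RHS](addKr ((\sum_(b <- u) w b * b)%:P * pole_prod u)) -IH.
ring.
Qed.

Local Notation toC p z := (map_poly (real_complex R) p).[z].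

Lemma conjC_realC (a : R) : (real_complex R a)^* = real_complex R a.
Proof. by apply/CrealP; rewrite complex_real. Qed.

Lemma pole_prod_neq0 u (z : R[i]) :
  z \isn't Num.real -> toC (pole_prod u) z != 0.
Proof.
apply: contra; elim: u => [|a u IH].
  by rewrite /pole_prod big_nil rmorph1 hornerC oner_eq0.
rewrite pole_prod_cons rmorphM hornerM mulf_eq0 => /orP[|/IH //].
rewrite rmorphB /= map_polyX map_polyC hornerXsubC subr_eq0 => /eqP->.
by rewrite complex_real.
Qed.

(** Divided by the square modulus of the product, the left-hand side is F - F^*
    for F the sum of the w a / (z - a), and 1 / (z - a) has an imaginary part of
    sign opposite to that of the imaginary part of z. *)
Lemma pole_sum_conj_gap w u (z : R[i]) : {in u, forall a, 0 <= w a} ->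
  z \isn't Num.real ->
  exists S : R[i], [/\ 0 <= S, has (fun a => 0 < w a) u -> 0 < S &
  toC (pole_sum w u) z * (toC (pole_prod u) z)^*
   - (toC (pole_sum w u) z)^* * toC (pole_prod u) z = - (z - z^*) * S].
Proof.
move=> w0 zNr; elim: u w0 => [|a u IH] w0.
  exists 0; split=> //; rewrite rmorph0 horner0 conjC0; ring.
have [|S [S0 Sgt ES]] := IH; first by move=> b bu; rewrite w0 // inE bu orbT.
set D := toC (pole_prod u) z in ES *; set N := toC (pole_sum w u) z in ES *.
have Dn : 0 < D * D^* by rewrite mul_conjC_gt0 pole_prod_neq0.
have zn : 0 < (z - real_complex R a) * (z - real_complex R a)^*.
  rewrite mul_conjC_gt0 subr_eq0; apply: contraNneq zNr => ->.
  by rewrite complex_real.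
have wa : 0 <= real_complex R (w a) by rewrite ler0c w0 // mem_head.
exists ((z - real_complex R a) * (z - real_complex R a)^* * S
        + real_complex R (w a) * (D * D^*)).
split.
- by apply: addr_ge0; apply: mulr_ge0 => //; apply: ltW.
- rewrite /= => /orP[wa0|/Sgt S1].
    apply: ltr_wpDl; first by apply: mulr_ge0 => //; apply: ltW.
    by apply: mulr_gt0 => //; rewrite ltcR.
  apply: ltr_pwDl; first exact: mulr_gt0.
  by apply: mulr_ge0 => //; apply: ltW.
rewrite pole_prod_cons /= rmorphD !rmorphM /= map_polyZ !rmorphB /=.
rewrite map_polyX map_polyC.
rewrite hornerD !hornerM hornerZ hornerXsubC -/D -/N.
rewrite !(rmorphD, rmorphN, rmorphM) /= !conjC_realC.
move: (D^*) (N^*) (z^*) ES => D' N' z' ES.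
have {}ES : N * D' = N' * D - (z - z') * S.
  by rewrite -[LHS](subrK (N' * D)) ES; ring.
ring: ES.
Qed.

(** At a nonreal root z the sum of the w a / (z - a) would be the real number
    - c, against the previous lemma. *)
Lemma prod_add_pole_sum_real_rooted w u c : {in u, forall a, 0 <= w a} ->
  has (fun a => 0 < w a) u -> real_rooted (c *: pole_prod u + pole_sum w u).
Proof.
move=> w0 hw z rz; apply/idPn => zNr.
have [S [_ /(_ hw) S0]] := pole_sum_conj_gap w0 zNr.
move: rz; rewrite rootE rmorphD /= map_polyZ hornerD hornerZ addrC.
rewrite addr_eq0 => /eqP->.
rewrite !rmorphN rmorphM /= conjC_realC => /esym/eqP.
rewrite [X in _ == X](_ : _ = 0); last by ring.
rewrite mulf_eq0 oppr_eq0 subr_eq0 (gt_eqF S0) orbF => /eqP e.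
by case/negP: zNr; apply/CrealP.
Qed.

(** * The Wronskian as a Cauchy-Schwarz gap *)

(** Writing y a = 1 / (x - a), this is, off the poles, pole_prod squared times the difference
    of (sum of w) (sum of w y^2) and (sum of w y)^2. *)
Definition pole_wronskian w u x : R :=
  (\sum_(a <- u) w a) *
    ((pole_prod u)^`().[x] * (pole_sum w u).[x]
     - (pole_prod u).[x] * (pole_sum w u)^`().[x]) - (pole_sum w u).[x] ^+ 2.

Lemma wronskian_polar_pole_sum w u x :
  (wronskian (polar_pole_sum w u) (pole_sum w u)).[x] = pole_wronskian w u x.
Proof.
rewrite /wronskian /polar_pole_sum /pole_wronskian !derivE !hornerE; ring.
Qed.

(** The step of the usual inductive proof of the Cauchy-Schwarz inequality,
    cleared of denominators so that it also holds at the poles. *)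
Lemma pole_wronskian_cons w a u x :
  (\sum_(b <- u) w b) * pole_wronskian w (a :: u) x =
  (\sum_(b <- a :: u) w b) * (x - a) ^+ 2 * pole_wronskian w u x
  + w a * ((\sum_(b <- u) w b) * (pole_prod u).[x]
           - (x - a) * (pole_sum w u).[x]) ^+ 2.
Proof.
rewrite /pole_wronskian !big_cons pole_prod_cons /= !derivE.
rewrite !(hornerXsubC, hornerD, hornerM, hornerZ) hornerC; ring.
Qed.

Lemma pole_wronskian1 w a x : pole_wronskian w [:: a] x = 0.
Proof.
rewrite /pole_wronskian big_seq1 pole_prod1 pole_sum1 derivC derivXsubC !hornerC; ring.
Qed.

(** Both terms of the recursion are nonnegative. When x is not the new pole a,
    the first one is positive by induction; when x = a, the second one is, as a
    is not among the other poles. Starting from one pole, where the form is 0,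
    the second term is a multiple of (a - b)^2. *)
Lemma pole_wronskian_gt0 w a b u x : (forall c, 0 < w c) -> uniq [:: a, b & u] ->
  0 < pole_wronskian w [:: a, b & u] x.
Proof.
move=> w0; elim: u a b => [|c u IH] a b; last first.
  rewrite cons_uniq => /andP[au /IH V].
  have C : 0 < \sum_(d <- [:: b, c & u]) w d.
    by rewrite !big_cons addrA ltr_pwDl ?addr_gt0 // sumr_ge0 // => d _; apply: ltW.
  rewrite -(pmulr_rgt0 _ C) pole_wronskian_cons (big_cons _ _ a).
  have [->|xa] := eqVneq x a.
    rewrite subrr expr0n /= mulr0 !mul0r add0r subr0 pmulr_rgt0 //.
    have Da : (pole_prod [:: b, c & u]).[a] != 0.
      by rewrite -[(_ == 0)]/(root _ _) root_prod_XsubC.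
    by rewrite exprn_even_gt0 //= mulf_neq0 // gt_eqF.
  apply: ltr_pwDl; last by rewrite mulr_ge0 ?sqr_ge0 // ltW.
  by rewrite mulr_gt0 // mulr_gt0 ?addr_gt0 // exprn_even_gt0 //= subr_eq0.
rewrite /= inE andbT => ab.
have C : 0 < \sum_(d <- [:: b]) w d by rewrite big_seq1.
rewrite -(pmulr_rgt0 _ C) pole_wronskian_cons pole_wronskian1 mulr0 add0r pmulr_rgt0 //.
rewrite exprn_even_gt0 // big_seq1 pole_prod1 pole_sum1 hornerXsubC hornerC.
have -> : w b * (x - b) - (x - a) * w b = w b * (a - b) by ring.
by rewrite mulf_neq0 ?subr_eq0 // gt_eqF.
Qed.

(** * Splitting off multiple roots *)

(** With e a one less than the multiplicity of a, and u the distinct roots, this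
    is the gcd of a split
    polynomial and its derivative. *)
Definition excess_prod (e : R -> nat) u : {poly R} :=
  \prod_(a <- u) ('X - a%:P) ^+ e a.

Lemma excess_prodM e u :
  excess_prod e u * pole_prod u = excess_prod (fun a => (e a).+1) u.
Proof.
rewrite /excess_prod /pole_prod -big_split.
by apply: eq_bigr => a _; rewrite exprSr.
Qed.

Lemma deriv_excess_prod e u :
  (excess_prod (fun a => (e a).+1) u)^`() =
  excess_prod e u * pole_sum (fun a => (e a).+1%:R) u.
Proof.
elim: u => [|a u IH]; first by rewrite /excess_prod !big_nil /= mulr0 derivC.
have cE e' : excess_prod e' (a :: u) = ('X - a%:P) ^+ e' a * excess_prod e' u.
  by rewrite /excess_prod big_cons.
rewrite !cE derivM deriv_exp derivXsubC mul1r IH /= -excess_prodM -mulr_natr exprS.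
rewrite scaler_nat -mulr_natr; ring.
Qed.

(** The multiplicity is written (_).-1.+1 because the weights of the pole sums
    must be positive at every real, including those that are not roots. *)
Lemma excess_prod_undup s :
  \prod_(a <- s) ('X - a%:P) =
  excess_prod (fun a => (count_mem a s).-1.+1) (undup s) :> {poly R}.
Proof.
rewrite -big_undup_iterop_count /= /excess_prod; apply: eq_big_seq => a.
by rewrite mem_undup -has_pred1 has_count => /prednK->.
Qed.

Lemma sum_count_undup s :
  \sum_(a <- undup s) (count_mem a s).-1.+1%:R = (size s)%:R :> R.
Proof.
rewrite -sum1_size natr_sum -[RHS]big_undup_iterop_count /=; apply: eq_big_seq => a.
rewrite mem_undup -has_pred1 has_count => /prednK->.
by elim: (count_mem a s) => // n; case: n => // n IH; rewrite mulrS IH.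
Qed.

Lemma polar_derivE q s : q = \prod_(a <- s) ('X - a%:P) ->
  let e a := (count_mem a s).-1 in
  polar_deriv q = excess_prod e (undup s) *
    polar_pole_sum (fun a => (e a).+1%:R) (undup s).
Proof.
move=> Dq e; rewrite /polar_deriv {1}Dq size_prod_XsubC /=.
rewrite /polar_pole_sum sum_count_undup Dq excess_prod_undup deriv_excess_prod.
rewrite -excess_prodM -!mul_polyC; ring.
Qed.

Lemma wronskianM g p q x :
  (wronskian (g * p) (g * q)).[x] = g.[x] ^+ 2 * (wronskian p q).[x].
Proof.
rewrite /wronskian !derivE !(hornerD, hornerN, hornerM); ring.
Qed.

Lemma polar_pole_sum_real_rooted w u : (forall a, 0 < w a) ->
  has (fun a => a != 0) u -> real_rooted (polar_pole_sum w u).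
Proof.
move=> w0 /hasP[a au a0]; apply: (@real_rooted_mull _ (- 'X)).
rewrite mulrN mulrC mulX_polar_pole_sum; apply: prod_add_pole_sum_real_rooted.
  by move=> b _; apply: mulr_ge0; rewrite ?sqr_ge0 // ltW.
by apply/hasP; exists a; rewrite // pmulr_rgt0 // exprn_even_gt0 ?a0 ?orbT.
Qed.

Lemma pole_sum_real_rooted w u : (forall a, 0 < w a) -> u != [::] ->
  real_rooted (pole_sum w u).
Proof.
move=> w0 u0; rewrite -[pole_sum w u]add0r -(scale0r (pole_prod u)).
apply: prod_add_pole_sum_real_rooted; first by move=> a _; apply: ltW.
by case: u u0 => //= a u _; rewrite w0.
Qed.

(** With a single pole a != 0 the Wronskian is identically 0, but then both
    polynomials are nonzero constants and have no roots. *)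
Lemma pole_wronskian_gt0_at_root w u x : (forall a, 0 < w a) -> uniq u ->
  has (fun a => a != 0) u ->
  root (polar_pole_sum w u) x || root (pole_sum w u) x ->
  0 < pole_wronskian w u x.
Proof.
case: u => [//|a [|b u]] w0 uu; last by move=> _ _; apply: pole_wronskian_gt0.
rewrite has_seq1 => a0; rewrite /polar_pole_sum pole_prod1 pole_sum1 big_seq1.
rewrite !rootE !hornerE.
have -> : w a * (x - a) - x * w a = - (w a * a) by ring.
by rewrite oppr_eq0 mulf_eq0 (negbTE a0) (gt_eqF (w0 a)).
Qed.

Lemma size_real_rooted p s : real_rooted p -> roots_decreasing p s ->
  size p = (size s).+1.
Proof.
move=> rp [_ cs]; have [t st Dp] := real_rooted_split rp.
have lp : lead_coef p != 0 by rewrite lead_coef_eq0 real_rooted_neq0.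
rewrite {1}Dp size_scale // size_prod_XsubC; congr _.+1.
apply: perm_size; apply/allP => x _ /=.
by rewrite cs Dp mupZ // mup_prod_XsubC.
Qed.

Lemma size_polar_deriv_le q : (size (polar_deriv q) <= (size q).-1)%N.
Proof.
apply/leq_sizeP => j lej; rewrite /polar_deriv coefB coefZ coefXM coef_deriv.
have [->|ne] := eqVneq j (size q).-1.
  case: (size q).-1 => [|n]; first by rewrite /= mul0r subrr.
  by rewrite /= mulr_natl subrr.
have q0 : q`_j = 0.
  apply: nth_default; apply: leq_trans (leqSpred _) _.
  by rewrite ltn_neqAle eq_sym ne.
by rewrite q0 mulr0; case: j q0 {lej ne} => [|j] /= q0; rewrite ?q0 ?mul0rn subrr.
Qed.

End PolarDerivative.

Theorem theorem2p2 (R : rcfType) (d : nat) (q : {poly R})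
  (q_monic : q \is monic) (q_deg : size q = d.+1)
  (q_real : real_rooted q) (q_neq : q <> 'X^d) :
  [/\ size (polar_deriv q) = d \/
        ((2 <= d)%N /\ size (polar_deriv q) = d.-1),
      real_rooted (polar_deriv q),
      interlace (polar_deriv q) q^`(),
      (forall x : R, 0 <= (wronskian (polar_deriv q) q^`()).[x])
    & ((2 <= d)%N -> simple_roots q ->
       forall x : R, 0 < (wronskian (polar_deriv q) q^`()).[x])].
Proof.
have [s _] := real_rooted_split q_real.
rewrite (monicP q_monic) scale1r => Dq.
have size_s : size s = d by apply/succn_inj; rewrite -q_deg Dq size_prod_XsubC.
pose u := undup s; pose e a := (count_mem a s).-1; pose w a : R := (e a).+1%:R.
have w0 a : 0 < w a by rewrite ltr0n.
have u0 : has (fun a => a != 0) u.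
  rewrite (eq_has_r (mem_undup s)); apply: contra_notT q_neq => /hasPn s0.
  rewrite Dq -size_s; elim: s s0 {Dq size_s u e w w0} => [|a s IH] s0.
    by rewrite big_nil expr0.
  rewrite big_cons /= exprS IH => [|b bs]; last by rewrite s0 // inE bs orbT.
  by have := s0 a (mem_head _ _); rewrite negbK => /eqP->; rewrite subr0.
have un : u != [::] by apply: contraTneq u0 => ->.
have Dpolar : polar_deriv q = excess_prod e u * polar_pole_sum w u.
  exact: polar_derivE.
have Dderiv : q^`() = excess_prod e u * pole_sum w u.
  by rewrite Dq excess_prod_undup deriv_excess_prod.
have rG : real_rooted (excess_prod e u).
  apply: (@real_rooted_mull _ _ (pole_prod u)).
  by rewrite excess_prodM -excess_prod_undup -Dq.
have rh := polar_pole_sum_real_rooted w0 u0.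
have rN := pole_sum_real_rooted w0 un.
have WE x : (wronskian (polar_deriv q) q^`()).[x] =
    (excess_prod e u).[x] ^+ 2 * pole_wronskian w u x.
  by rewrite Dpolar Dderiv wronskianM wronskian_polar_pole_sum.
have inter : interlace (polar_deriv q) q^`().
  rewrite Dpolar Dderiv; apply: interlace_of_wronskian => // x.
  rewrite wronskian_polar_pole_sum.
  by apply: pole_wronskian_gt0_at_root; rewrite ?undup_uniq.
have wr_gt0 x : (size u = 1%N) \/ 0 < pole_wronskian w u x.
  have := undup_uniq s; rewrite -/u.
  case: (u) un => [//|a [|b v]] _ uu; first by left.
  by right; apply: pole_wronskian_gt0.
have wr1 x : size u = 1%N -> pole_wronskian w u x = 0.
  by case: (u) => [|a []] // _; apply: pole_wronskian1.
split=> //; last first.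
- move=> d2 simq x; rewrite WE.
  have e0 a : a \in u -> e a = 0%N.
    rewrite mem_undup /e => au; rewrite -mup_prod_XsubC -Dq simq //.
    by rewrite Dq root_prod_XsubC.
  have G1 : excess_prod e u = 1.
    by rewrite /excess_prod big_seq big1 // => a /e0->; rewrite expr0.
  rewrite G1 hornerC expr1n mul1r; case: (wr_gt0 x) => // u1.
  have : \sum_(a <- u) w a = d%:R by rewrite -size_s -sum_count_undup.
  rewrite big_seq (eq_bigr (fun=> 1)) => [|a /e0]; last by rewrite /w => ->.
  rewrite -big_seq big_const_seq count_predT u1 /= addr0 => /eqP.
  by rewrite (@eqr_nat R 1 d) => /eqP d1; rewrite -d1 in d2.
- move=> x; rewrite WE; case: (wr_gt0 x) => [/wr1->|W]; first by rewrite mulr0.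
  by rewrite mulr_ge0 ?sqr_ge0 // ltW.
- by rewrite Dpolar; apply: real_rootedM.
(* Interlacing root lists differ in length by at most one, which bounds the
   degree of the polar derivative from below. *)
case: inter => rp rd [s1 [s2 [d1 d2 il]]].
have := size_polar_deriv_le q.
have := size_real_rooted rp d1; have := size_real_rooted rd d2.
rewrite size_deriv q_deg /=.
by case: il => [[]|[]|[]] => e1 _ e2 e3; lia.
Qed.
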